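(* Let $P$ be the set of centers of tiles of one of the regular tilings $\mathcal{T}\in\{(4^4),(6^3),(3^6)\}$ (positioned as in the context), and let $\varphi_\alpha(z)=\exp(2\pi i z/\alpha)$ with $\alpha$ admissible for $\mathcal{T}$. Let $\mathcal{S}_\alpha=\{\varphi_\alpha(T): T\in\mathcal{T}\}$ and $Q_\alpha=\{\varphi_\alpha(t): t\in P\}$. Suppose a coloring $\mathcal{C}_P$ of $P$ is compatible with $\varphi_\alpha$. If $g\in\mathrm{S}(\mathcal{S}_\alpha)$ and $f\in\mathrm{S}(\mathcal{T})$ corresponds to $g$, then $g$ is a color symmetry of the coloring $\varphi_\alpha(\mathcal{C}_P)$ of $Q_\alpha$ if and only if $f$ is a color symmetry of $\mathcal{C}_P$.
   Context: The plane is identified with $\mathbb{C}$, $\mathbb{C}^*=\mathbb{C}\setminus\{0\}$, $i=\sqrt{-1}$, $\omega=e^{2\pi i/3}$. The regular tilings are positioned as follows; $P$ is the set of centers of the tiles and $\Lambda$ the orbit of $0$ under the group of translations preserving $\mathcal{T}$. $(4^4)$: unit squares with $P=\mathbb{Z}[i]$; $\Lambda=\mathbb{Z}[i]$. $(6^3)$: regular hexagons with $P=\mathbb{Z}[\omega]$; $\Lambda=\mathbb{Z}[\omega]$. $(3^6)$: equilateral triangles whose set of vertices is the ideal $P_0=(2+\omega)$ of $\mathbb{Z}[\omega]$ (side length $\sqrt3$); $P=\mathbb{Z}[\omega]\setminus P_0$ and $\Lambda=P_0$. A number $\alpha\in\mathbb{C}^*$ is admissible for $\mathcal{T}$ if $\alpha\in\Lambda$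 and $|\alpha|>\max\{|z_1-z_2| : z_1,z_2\in\partial T,\ T\in\mathcal{T}\}$; in that case $\mathcal{S}_\alpha$ is a tiling of $\mathbb{C}^*$. For a set $X$ of points or tiles, $\mathrm{S}(X)$ is the group of isometries of the plane mapping $X$ onto itself. One has $\mathrm{S}(\mathcal{T})=\mathrm{S}(P)$ and $\mathrm{S}(\mathcal{S}_\alpha)\subseteq\mathrm{S}(Q_\alpha)$. An $f\in\mathrm{S}(\mathcal{T})$ corresponds to $g\in\mathrm{S}(\mathcal{S}_\alpha)$ if $g\circ\varphi_\alpha=\varphi_\alpha\circ f$ on $\mathbb{C}$. A coloring of a set $X$ is a surjective map $\mathcal{C}_X:X\to K$ onto a finite set $K$ of colors, equivalently a partition $\{X_i\}_{i=1}^m$ of $X$ into nonempty classes. A color symmetry of $\mathcal{C}_X$ is an $h\in\mathrm{S}(X)$ that permutes the colors: there is a permutation $\sigma_h$ of $K$ with $\mathcal{C}_X(h(x))=\sigma_h(\mathcal{C}_X(x))$ for all $x\in X$. A coloring $\mathcal{C}_P=\{X_i\}_{i=1}^m$ of $P$ is compatible with $\varphi_\alpha$ if $\{\varphi_\alpha(X_i)\}_{i=1}^m$ is a coloring of $Q_\alpha$ in the sense that each point of $Q_\alpha$ receives exactly one color, i.e. $\varphi_\alpha(X_i)\cap\varphi_\alpha(X_j)=\varnothing$ for $i\neq j$; this coloring of $Q_\alpha$ is denoted $\varphi_\alpha(\mathcal{C}_P)$. *)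

(* Defs.v *)
From HB Require Import structures.
From mathcomp Require Import all_boot all_order all_fingroup all_algebra.
From mathcomp Require Import all_classical all_reals all_analysis.
From mathcomp Require Import complex.
Set Implicit Arguments.
Unset Strict Implicit.
Unset Printing Implicit Defensive.
Import Order.TTheory GRing.Theory Num.Theory.
Import numFieldNormedType.Exports.
Local Open Scope classical_set_scope.
Local Open Scope ring_scope.

Section Plane.
Variable R : realType.

(* The plane is R[i]. The norm `|z| takes values in R[i], where x < y means
   that x and y have the same imaginary part and Re x < Re y; on norms this is
   the order of R. *)

Definition imagC : R[i] := Complex 0 1.

Definition cexp (z : R[i]) : R[i] :=
  Complex (expR (complex.Re z) * cos (complex.Im z))
          (expR (complex.Re z) * sin (complex.Im z)).

Definition two_pi_i : R[i] := 2 * (pi : R)%:C%C * imagC.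

Definition omega : R[i] := cexp (two_pi_i / 3).

(* Equal to the ring Z[w] when w is a quadratic integer, as i and omega are. *)
Definition int_adjoin (w : R[i]) : set R[i] :=
  [set z | exists a b : int, z = a%:~R + b%:~R * w].

Definition gaussian_integers : set R[i] := int_adjoin imagC.
Definition eisenstein_integers : set R[i] := int_adjoin omega.

Definition eisenstein_ideal : set R[i] :=
  [set (2 + omega) * z | z in eisenstein_integers].

(* Convexity is taken in Rcomplex R, i.e., R[i] as a real vector space. *)
Definition convex_hull (V : set R[i]) : set R[i] :=
  smallest (@convex_set R (Rcomplex R)) V.

Definition boundary (T : set R[i]) : set R[i] :=
  closure (T : set R[i]^o) `\` interior (T : set R[i]^o).

Inductive regular_tiling := Tiling44 | Tiling63 | Tiling36.

Definition centers (tau : regular_tiling) : set R[i] :=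
  match tau with
  | Tiling44 => gaussian_integers
  | Tiling63 => eisenstein_integers
  | Tiling36 => eisenstein_integers `\` eisenstein_ideal
  end.

(* Tiling44: (1 + i)/2 is a corner of the unit square centered at 0.
   Tiling63: the hexagon centered at 0 has inradius 1/2; (2 + omega)/3 is its
   vertex of argument pi/6, and 1 + omega = exp(i pi/3).
   Tiling36: a triangle of side sqrt 3 has circumradius 1. *)
Definition tile_vertices (tau : regular_tiling) (t : R[i]) : set R[i] :=
  match tau with
  | Tiling44 => [set t + imagC ^+ k * ((1 + imagC) / 2) | k in [set: nat]]
  | Tiling63 => [set t + (1 + omega) ^+ k * ((2 + omega) / 3) | k in [set: nat]]
  | Tiling36 => [set v | eisenstein_ideal v /\ `|v - t| = 1]
  end.

Definition tile (tau : regular_tiling) (t : R[i]) : set R[i] :=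
  convex_hull (tile_vertices tau t).

Definition tiling (tau : regular_tiling) : set (set R[i]) :=
  [set tile tau t | t in centers tau].

Definition plane_isometry (h : R[i] -> R[i]) : Prop :=
  bijective h /\ forall z w, `|h z - h w| = `|z - w|.

Definition sym_points (X : set R[i]) : set (R[i] -> R[i]) :=
  [set h | plane_isometry h /\ h @` X = X].

Definition sym_tiles (X : set (set R[i])) : set (R[i] -> R[i]) :=
  [set h | plane_isometry h /\ [set h @` T | T in X] = X].

(* The orbit of 0 under the translations preserving the tiling: the translation
   by v sends 0 to v. It is Z[i], Z[omega] and the ideal (2 + omega) in the three
   respective cases. *)
Definition translation_lattice (tau : regular_tiling) : set R[i] :=
  [set v | sym_tiles (tiling tau) (fun z => z + v)].

Definition boundary_distances (tau : regular_tiling) : set R[i] :=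
  [set d | exists T z1 z2, [/\ tiling tau T, boundary T z1, boundary T z2 &
                               d = `|z1 - z2|]].

Definition is_max (A : set R[i]) (d : R[i]) : Prop := A d /\ ubound A d.

Definition admissible (tau : regular_tiling) (alpha : R[i]) : Prop :=
  [/\ alpha != 0, translation_lattice tau alpha &
      exists2 d, is_max (boundary_distances tau) d & d < `|alpha| ].

Definition phi (alpha z : R[i]) : R[i] := cexp (two_pi_i * z / alpha).

Definition spiral_tiling (tau : regular_tiling) (alpha : R[i]) :
    set (set R[i]) :=
  [set phi alpha @` T | T in tiling tau].

Definition spiral_centers (tau : regular_tiling) (alpha : R[i]) : set R[i] :=
  phi alpha @` centers tau.

Definition corresponds (alpha : R[i]) (f g : R[i] -> R[i]) : Prop :=
  g \o phi alpha =1 phi alpha \o f.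

Section Colorings.
Variable K : finType.

(* A coloring is given by its color classes C k, k in K. *)
Definition is_coloring (X : set R[i]) (C : K -> set R[i]) : Prop :=
  partition [set: K] C X.

Definition color_symmetry (X : set R[i]) (C : K -> set R[i])
    (h : R[i] -> R[i]) : Prop :=
  sym_points X h /\
  exists sigma : {perm K}, forall k x, C k x -> C (sigma k) (h x).

Definition phi_coloring (alpha : R[i]) (C : K -> set R[i]) : K -> set R[i] :=
  fun k => phi alpha @` C k.

Definition compatible (tau : regular_tiling) (alpha : R[i])
    (C : K -> set R[i]) : Prop :=
  is_coloring (spiral_centers tau alpha) (phi_coloring alpha C).

End Colorings.
End Plane.

(* Main.v *)
Require Import Defs.
From mathcomp Require Import all_boot all_order all_fingroup all_algebra.
From mathcomp Require Import all_classical all_reals all_analysis.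
From mathcomp Require Import complex.
From mathcomp Require Import ring lra zify.

(** A tile is contained in exactly one closed disk of its circumradius, the one
    about its center: it contains finitely many points of the circumscribed
    circle with barycenter at the center, and moving the disk away from this
    barycenter increases the mean squared distance to these points.  An isometry
    preserving the tiling therefore maps centers to centers, so that f and g
    preserve P and Q.  The equivalence then follows because phi sends distinct
    colors to disjoint sets. *)

Set Implicit Arguments.
Unset Strict Implicit.
Unset Printing Implicit Defensive.
Import Order.TTheory GRing.Theory Num.Theory.
Local Open Scope classical_set_scope.
Local Open Scope ring_scope.

Section TileCenters.
Variable R : realType.
Implicit Types (t u v z c r : R[i]) (tau : regular_tiling).

Lemma sqr_imagC : imagC R ^+ 2 = -1.
Proof.
rewrite expr2; apply/eqP; rewrite eq_complex /=.
by apply/andP; split; apply/eqP; ring.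
Qed.

Lemma norm_imagC : `|imagC R| = 1.
Proof.
apply/eqP; rewrite -(@pexpr_eq1 _ _ 4) //.
by rewrite -normrX (exprM _ 2 2) sqr_imagC sqrrN expr1n normr1.
Qed.

Lemma cexpD z c : cexp (z + c) = cexp z * cexp c.
Proof.
case: z c => [a b] [x y]; rewrite /cexp /= expRD cosD sinD.
by apply/eqP; rewrite eq_complex /=; apply/andP; split; apply/eqP; ring.
Qed.

Lemma two_pi_i_third : two_pi_i R / 3 = Complex 0 (2 * pi / 3).
Proof.
apply: (mulIf (_ : (3 : R[i]) != 0)); first by rewrite pnatr_eq0.
rewrite divfK ?pnatr_eq0// /two_pi_i /imagC.
rewrite -(rmorph_nat (real_complex R) 2) -(rmorph_nat (real_complex R) 3).
by apply/eqP; rewrite eq_complex /=; apply/andP; split; apply/eqP; field.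
Qed.

Lemma omega_cube : omega R ^+ 3 = 1.
Proof.
rewrite /omega !exprS expr0 mulr1 -!cexpD two_pi_i_third.
have -> : Complex 0 (2 * pi / 3) + (Complex 0 (2 * pi / 3) + Complex 0 (2 * pi / 3))
    = Complex 0 (pi *+ 2) :> R[i].
  by apply/eqP; rewrite eq_complex /=; apply/andP; split; apply/eqP; field.
by rewrite /cexp /= expR0 cos2pi sin2pi mulr1 mulr0.
Qed.

Lemma omega_neq1 : omega R != 1.
Proof.
rewrite /omega two_pi_i_third eq_complex /= expR0 mul1r negb_and; apply/orP; right.
rewrite gt_eqF// mul1r sin_gt0_pi//; have := pi_gt0 R; lra.
Qed.

Lemma omega_minpoly : omega R ^+ 2 + omega R + 1 = 0.
Proof.
apply: (mulfI (_ : omega R - 1 != 0)); first by rewrite subr_eq0 omega_neq1.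
transitivity (omega R ^+ 3 - 1); first by ring.
by rewrite omega_cube subrr mulr0.
Qed.

Lemma norm_omega : `|omega R| = 1.
Proof. by apply/eqP; rewrite -(@pexpr_eq1 _ _ 3)// -normrX omega_cube normr1. Qed.

Lemma sqr_omega : omega R ^+ 2 = - 1 - omega R.
Proof. by apply/eqP; rewrite -subr_eq0 -omega_minpoly; apply/eqP; ring. Qed.

(** The rotation by pi/3 that generates the hexagon vertices is thereby tied to [omega]: its norm is
    1 and its cube is -1. *)
Lemma one_add_omega : 1 + omega R = - omega R ^+ 2.
Proof. by rewrite sqr_omega; ring. Qed.

(* [(2 + omega) (x + y omega) = (2 x - y) + (x + y) omega], and these
   coefficients add up to [3 x]. *)
Lemma eisenstein_ideal_dvd3 (a b c : int) :
  a + b = 3 * c -> eisenstein_ideal (a%:~R + b%:~R * omega R).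
Proof.
move=> /(canRL (addrK _)) ->; exists (c%:~R + (b - c)%:~R * omega R).
  by exists c, (b - c).
transitivity ((2 * c)%:~R + (c + 2 * (b - c))%:~R * omega R
    + (b - c)%:~R * omega R ^+ 2); first by rewrite !(rmorphM, rmorphD, rmorphB) /=; ring.
by rewrite sqr_omega !(rmorphM, rmorphD, rmorphB) /=; ring.
Qed.

(** The values 1/sqrt 2 and 1/sqrt 3 of the first two cases are kept as norms of the reference
    vertex. *)
Definition circumradius tau : R[i] :=
  match tau with
  | Tiling44 => `|(1 + imagC R) / 2|
  | Tiling63 => `|(2 + omega R) / 3|
  | Tiling36 => 1
  end.

Lemma norm_tile_vertex tau t v :
  tile_vertices tau t v -> `|v - t| = circumradius tau.
Proof.
case: tau => /= [[k _ <-]|[k _ <-]|[] //]; rewrite addrC addKr normrM normrX.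
  by rewrite norm_imagC expr1n mul1r.
by rewrite one_add_omega normrN normrX norm_omega !expr1n mul1r.
Qed.

(** Two opposite vertices suffice for squares and hexagons; a triangle has no such pair, so all
    three of its vertices are taken. *)
Lemma balanced_tile_vertices tau t : centers tau t ->
  exists s : seq R[i], [/\ s != [::], \sum_(u <- s) u = 0 &
    {in s, forall u, tile_vertices tau t (t + u)}].
Proof.
case: tau => /= [_|_|].
- pose u := (1 + imagC R) / 2; exists [:: u; - u]; split => //.
    by rewrite !big_cons big_nil addr0 subrr.
  move=> v; rewrite !inE => /orP[] /eqP ->.
    by exists 0 => //; rewrite expr0 mul1r.
  by exists 2 => //; rewrite sqr_imagC mulN1r.
- pose u := (2 + omega R) / 3; exists [:: u; - u]; split => //.
    by rewrite !big_cons big_nil addr0 subrr.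
  move=> v; rewrite !inE => /orP[] /eqP ->.
    by exists 0 => //; rewrite expr0 mul1r.
  (* Three rotations by pi/3 make the half turn: [(1 + omega) ^+ 3 = -1]. *)
  exists 3 => //.
  rewrite one_add_omega exprNn -exprM mulnC exprM omega_cube expr1n mulr1.
  by rewrite -signr_odd /= mulN1r.
- move=> [[a [b ->]] nt].
  (* Since the center is not in the ideal, [a + b] is 1 or 2 modulo 3, so a unit [e] = -1 or 1 makes
     [a + b + e] divisible by 3. The vertices are then the center plus [e], [e * omega] and
     [e * omega ^+ 2]. *)
  have [[e c] /= e1 abe] : exists2 p : int * int,
      `|p.1| = 1 & a + b + p.1 = 3 * p.2.
    have q3 := divz_eq (a + b) 3.
    have [r0|[r1|r2]] : ((a + b) %% 3 = 0 \/ (a + b) %% 3 = 1 \/ (a + b) %% 3 = 2)%Z.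
    + by lia.
    + by case: nt; apply: (@eisenstein_ideal_dvd3 _ _ ((a + b) %/ 3)%Z); lia.
    + by exists (-1, ((a + b) %/ 3)%Z) => //=; lia.
    + by exists (1, ((a + b) %/ 3)%Z + 1) => //=; lia.
  pose u : R[i] := e%:~R.
  have nu k : `|u * omega R ^+ k| = 1.
    by rewrite normrM normrX norm_omega expr1n mulr1 -intr_norm e1.
  exists [:: u; u * omega R; u * omega R ^+ 2]; split => //.
    rewrite !big_cons big_nil.
    transitivity (u * (omega R ^+ 2 + omega R + 1)); first by ring.
    by rewrite omega_minpoly mulr0.
  move=> v; rewrite !inE => /or3P[] /eqP ->; (split; last first).
  + by rewrite addrC addKr -[u]mulr1 (nu 0).
  + have -> : a%:~R + b%:~R * omega R + u = (a + e)%:~R + b%:~R * omega R.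
      by rewrite rmorphD /=; ring.
    by apply: (@eisenstein_ideal_dvd3 _ _ c); lia.
  + by rewrite addrC addKr (nu 1).
  + have -> : a%:~R + b%:~R * omega R + u * omega R = a%:~R + (b + e)%:~R * omega R.
      by rewrite rmorphD /=; ring.
    by apply: (@eisenstein_ideal_dvd3 _ _ c); lia.
  + by rewrite addrC addKr.
  + have -> : a%:~R + b%:~R * omega R + u * omega R ^+ 2
        = (a - e)%:~R + (b - e)%:~R * omega R.
      by rewrite sqr_omega !rmorphB /=; ring.
    (* As [omega ^+ 2 = - 1 - omega], both coefficients drop by [e], and
       [a + b - 2 e = 3 (c - e)]. *)
    by apply: (@eisenstein_ideal_dvd3 _ _ (c - e)); lia.
Qed.

(** The disk is convex and contains the vertices, hence contains their hull. *)
Lemma tile_sub_disk tau t z : tile tau t z -> `|z - t| <= circumradius tau.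
Proof.
move: z; apply: smallest_sub => [|v /norm_tile_vertex /= -> //].
move=> x y l; rewrite !inE /= => hx hy.
have [l0 l1] : 0 <= l%:num /\ l%:num <= 1 by [].
set w := (X in `|X - t|).
(* The convex combination is formed in the real vector space; coordinates turn it into products in
   [R[i]]. *)
have -> : w - t = (l%:num)%:C%C * (x - t) + (1 - l%:num)%:C%C * (y - t).
  rewrite {}/w; case: x y t {hx hy} => [a b] [a' b'] [t1 t2].
  by apply/eqP; rewrite eq_complex /= /unstable.onem; apply/andP; split; apply/eqP; ring.
apply: (le_trans (ler_normD _ _)); rewrite !normrM.
have n0 (a : R) : 0 <= a -> `|a%:C%C| = a%:C%C by move=> a0; rewrite ger0_norm ?ler0c.
rewrite !n0 ?subr_ge0//.
have -> : circumradius tau = l%:num%:C%C * circumradius tau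
    + (1 - l%:num)%:C%C * circumradius tau by rewrite rmorphB /=; ring.
by rewrite lerD// ler_wpM2l// ler0c ?subr_ge0.
Qed.

(** In the sum of [|u - c|^2] the cross terms vanish with the sum of the [u], leaving an excess of
    [size s] times [|c|^2] over the sum of [|u|^2]. The disk condition forces this excess to be at
    most 0. *)
Lemma balanced_circle_center (s : seq R[i]) r c :
  s != [::] -> \sum_(u <- s) u = 0 -> {in s, forall u, `|u| = r} ->
  {in s, forall u, `|u - c| <= r} -> c = 0.
Proof.
move=> s0 sum0 nr nc.
have : \sum_(u <- s) `|u - c| ^+ 2 <= \sum_(u <- s) `|u| ^+ 2.
  rewrite big_seq [leRHS]big_seq; apply: ler_sum => u us.
  by rewrite lerXn2r ?nnegrE// (nr u) ?nc.
have -> : \sum_(u <- s) `|u - c| ^+ 2 =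
    \sum_(u <- s) `|u| ^+ 2 + (size s)%:R * `|c| ^+ 2.
  under eq_bigr => u _.
    have -> : `|u - c| ^+ 2 = `|u| ^+ 2 + `|c| ^+ 2 - u * c^* - c * u^*.
      by rewrite !normCK rmorphB /=; ring.
    over.
  have sumJ : \sum_(u <- s) u^* = 0 by rewrite -rmorph_sum /= sum0 rmorph0.
  rewrite !big_split /= !sumrN -[X in _ - X - _]mulr_suml -[X in _ - X]mulr_sumr.
  by rewrite sum0 sumJ mul0r mulr0 !subr0 big_const_seq count_predT iter_addr_0 mulr_natl.
rewrite gerDl pmulr_rle0 ?ltr0n ?lt0n ?size_eq0//.
by rewrite -normrX normr_le0 sqrf_eq0 => /eqP.
Qed.

Lemma tile_center_unique tau t c : centers tau t ->
  (forall z, tile tau t z -> `|z - c| <= circumradius tau) -> c = t.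
Proof.
move=> /balanced_tile_vertices[s [s0 sum0 sV]] tc.
apply/eqP; rewrite -subr_eq0; apply/eqP.
apply: (balanced_circle_center (r := circumradius tau) s0 sum0) => u us.
  by rewrite -(norm_tile_vertex (sV _ us)) addrC addKr.
rewrite opprB addrA (addrC u); apply: tc.
by apply: sub_gen_smallest; exact: sV.
Qed.

(** The isometry carries the disk about [t] to the disk about [f t], which then contains
    [tile tau t']; uniqueness of the center applies. *)
Lemma sym_tiling_tile tau (f : R[i] -> R[i]) t t' : sym_tiles (tiling tau) f ->
  centers tau t' -> f @` tile tau t = tile tau t' -> f t = t'.
Proof.
move=> [[_ fiso] _] Pt' ftt'; apply: tile_center_unique Pt' _ => z.
by rewrite -ftt' => -[x tx <-]; rewrite fiso tile_sub_disk.
Qed.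

Lemma sym_tiling_centers tau (f : R[i] -> R[i]) :
  sym_tiles (tiling tau) f -> f @` centers tau = centers tau.
Proof.
move=> hf; have [_ fT] := hf; apply/seteqP; split => [_ [t Pt <-]|t' Pt'].
  have : tiling tau (f @` tile tau t) by rewrite -fT; exists (tile tau t) => //; exists t.
  by case=> t' Pt' /esym/(sym_tiling_tile hf Pt') ->.
have : tiling tau (tile tau t') by exists t'.
by rewrite -fT => -[_ [t Pt <-] /(sym_tiling_tile hf Pt') <-]; exists t.
Qed.

End TileCenters.

Theorem theorem14 (R : realType) (tau : regular_tiling) (alpha : R[i])
    (halpha : admissible tau alpha)
    (K : finType) (C : K -> set R[i])
    (hC : is_coloring (centers tau) C)
    (hcompat : compatible tau alpha C)
    (f g : R[i] -> R[i])
    (hg : sym_tiles (spiral_tiling tau alpha) g)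
    (hf : sym_tiles (tiling tau) f)
    (hfg : corresponds alpha f g) :
  color_symmetry (spiral_centers tau alpha) (phi_coloring alpha C) g <->
  color_symmetry (centers tau) C f.
Proof.
have fP := sym_tiling_centers hf.
have gphi z : g (phi alpha z) = phi alpha (f z) by exact: hfg.
have [coverC _ _] := hC; have [_ trivC _] := hcompat.
split=> -[_ [sigma hsigma]].
  split; first by split => //; exact: hf.1.
  exists sigma => k x Ckx.
  have : centers tau (f x) by rewrite -fP; exists x => //; rewrite -coverC; exists k.
  rewrite -coverC => -[j _ Cjfx].
  (* The images under [phi alpha] of the classes [j] and [sigma k] share the point
     [phi alpha (f x)], so compatibility identifies the two colors. *)
  suff <- : j = sigma k by [].
  apply: trivC => //; exists (phi alpha (f x)); split; first by exists (f x).
  by rewrite -gphi; apply: hsigma; exists x.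
split.
  split; first exact: hg.1.
  (* [g] preserves the spiral centers because [f] preserves the centers and [phi alpha] intertwines
     the two maps. *)
  rewrite /spiral_centers -[in RHS]fP !image_comp; congr image.
  by apply/funext => z /=; exact: gphi.
exists sigma => k _ [x Ckx <-]; rewrite gphi.
by exists (f x) => //; exact: hsigma.
Qed.
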